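(* Let $S$ be a set of triangles satisfying Condition ( * ) such that $Forb_c(S)$ is a prioritised semi-free amalgamation class with respect to the linearly ordered $\mathcal L'=\{R_1>\dots>R_m\}\subsetneq\mathcal L$, and let $\mathcal M_S$ be its Fraïssé limit. Let $g\in\mathrm{Aut}(\mathcal M_S)$ be such that for every non-algebraic 1-type $p$ over a finite set there are infinitely many realisations $a$ of $p$ with $\mathbf r(a,ga)\in\mathcal L'$. Then there exists $k\in\mathrm{Aut}(\mathcal M_S)$ such that $[k,g]$ moves almost maximally.
   Context: $\mathcal L$ is a language of binary relation symbols interpreted as symmetric irreflexive relations; a structure is complete if any two distinct elements $a,b$ are related by exactly one relation, denoted $\mathbf r(a,b)$. A triangle is a complete structure on three points, specified by the multiset of its edge relations. $Forb_c(S)$ is the class of finite complete structures embedding no triangle of $S$, assumed to be an amalgamation class; $\mathcal M_S$ is its Fraïssé limit. $AB$ denotes the substructure on $A\cup B$, $aB=\{a\}\cup B$. For $A,B,C\in Forb_c(S)$ with $B$ common substructure of $A,C$, $A\otimes_B C$ is the complete structure on the disjoint union of $A,C$ over $B$ extending both, with $\mathbf r(a,c)=R_i$ for $a\in A\setminus B$, $c\in C\setminus B$, where $i$ is least such that no $b\in B$ makes the triangle with edges $\mathbf r(a,b),\mathbf r(b,c),R_i$ lie in $S$ ($R_1$ if $B=\emptyset$). Prioritised semi-free amalgamation class: $A\otimes_B C$ is always defined and in $Forb_c(S)$. $A\mathrel{\perp\!\!\!\perp}_B C$ means the substructure of $\mathcal M_S$ on $A\cup B\cup C$ equals $AB\otimes_B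 BC$. Condition ( * ): (i) $S$ contains no triangle having two edges coloured $R_1,R_1$ or $R_1,R_2$; (ii) for all $a,b,c\in\mathcal M_S$ and finite $B$, if $a\mathrel{\perp\!\!\!\perp}_{bB}c$ and $\mathbf r(a,b)\in\mathcal L'$ then $a\mathrel{\perp\!\!\!\perp}_B c$. A 1-type over finite $X$ is an orbit of a single element under the pointwise stabiliser of $X$; realisations are its elements; non-algebraic means infinite. An automorphism $f$ moves almost maximally if every 1-type over every finite $X$ has a realisation $a$ with $a\mathrel{\perp\!\!\!\perp}_X fa$. $[k,g]=k^{-1}g^{-1}kg$. *)

(* Defs.v *)
From mathcomp Require Import all_boot finmap multiset.
From mathcomp Require Import boolp classical_sets functions cardinality.

Set Implicit Arguments.
Unset Strict Implicit.
Unset Printing Implicit Defensive.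

Local Open Scope classical_set_scope.

Section Structures.
Variable L : Type.

Record structure := Structure {
  dom :> Type;
  edge : L -> dom -> dom -> Prop;
  edge_sym : forall R a b, edge R a b -> edge R b a;
  edge_irr : forall R a, ~ edge R a a }.

(* In a complete structure [edge P a b] says that [r(a,b) = P]. *)
Definition complete (X : structure) :=
  forall a b : X, a <> b -> exists! P, edge P a b.

Definition embedding (X Y : structure) (f : X -> Y) :=
  injective f /\ forall P a b, edge P (f a) (f b) <-> edge P a b.

Definition induced (X : structure) (A : set X) : structure :=
  @Structure A (fun P a b => edge P (val a) (val b))
    (fun P a b => @edge_sym X P (val a) (val b))
    (fun P a => @edge_irr X P (val a)).

Record aut (X : structure) := Aut {
  aut_fun :> X -> X;
  aut_invfun : X -> X;
  aut_funK : cancel aut_fun aut_invfun;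
  aut_invfunK : cancel aut_invfun aut_fun;
  aut_edge : forall P a b, edge P (aut_fun a) (aut_fun b) <-> edge P a b }.

Definition aut_inv X (f : aut X) : aut X.
Proof.
exists (aut_invfun f) f; [exact: aut_invfunK|exact: aut_funK|].
by move=> P a b; rewrite -(aut_edge f) !aut_invfunK.
Defined.

Definition aut_mul X (f g : aut X) : aut X.
Proof.
exists (f \o g) (aut_invfun g \o aut_invfun f).
- exact: can_comp (aut_funK f) (aut_funK g).
- exact: can_comp (aut_invfunK g) (aut_invfunK f).
- by move=> P a b; rewrite /= !aut_edge.
Defined.

(* Automorphisms act on the left: [aut_mul f g] maps [a] to [f (g a)]. *)
Definition aut_comm X (k g : aut X) : aut X :=
  aut_mul (aut_inv k) (aut_mul (aut_inv g) (aut_mul k g)).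

Definition homogeneous (M : structure) :=
  forall (A : set M) (f : induced A -> M), finite_set A -> embedding f ->
  exists h : aut M, forall x : induced A, h (val x) = f x.

Definition fraisse_limit (K : structure -> Prop) (M : structure) :=
  [/\ countable [set: M],
      homogeneous M &
      forall X : structure,
        K X <-> finite_set [set: X] /\ exists f : X -> M, embedding f].

Definition amalgamation_class (K : structure -> Prop) :=
  [/\ forall (X Y : structure) (f : X -> Y), embedding f -> K Y -> K X,
      forall A C : structure, K A -> K C ->
        exists (D : structure) (i : A -> D) (j : C -> D),
          [/\ K D, embedding i & embedding j] &
      forall (A B C : structure) (f : B -> A) (h : B -> C),
        K A -> K B -> K C -> embedding f -> embedding h ->
        exists (D : structure) (i : A -> D) (j : C -> D),
          [/\ K D, embedding i, embedding j & i \o f =1 j \o h]].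

Definition one_type (M : structure) (X p : set M) :=
  exists a, p = [set b | exists h : aut M, (forall x, X x -> h x = x) /\ h a = b].

End Structures.

Section Prioritised.
Variables (L : choiceType) (S : set {mset L}%mset) (m : nat) (R : 'I_m -> L).

(* A triangle is encoded by the multiset of its three edge relations. *)
Definition triangles := forall t, S t -> size t = 3.

Definition Forb_c (X : structure L) :=
  [/\ finite_set [set: X], complete X &
      forall (a b c : X) P Q T, edge P a b -> edge Q b c -> edge T a c ->
        ~ S [mset P; Q; T]%mset].

Definition blocked (D : structure L) (B : set D) (a c : D) (i : 'I_m) :=
  exists b P Q, [/\ B b, edge P a b, edge Q b c & S [mset P; Q; R i]%mset].

(* The substructure of [D] on the union of [A] and [C] is the amalgam of [A]
   and [C] over [B], where [B] is contained in both. As a point is not related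
   to itself, the second clause implies that [A] and [C] meet in [B] only. *)
Definition is_amalgam (D : structure L) (A B C : set D) :=
  B `<=` A `&` C /\
  forall a c, (A `\` B) a -> (C `\` B) c ->
    exists i, [/\ edge (R i) a c, ~ blocked B a c i &
                  forall j : 'I_m, (j < i)%N -> blocked B a c j].

Definition prioritised_semifree :=
  amalgamation_class Forb_c /\
  forall (A B C : structure L) (f : B -> A) (h : B -> C),
    Forb_c A -> Forb_c B -> Forb_c C -> embedding f -> embedding h ->
    exists (D : structure L) (i : A -> D) (j : C -> D),
      [/\ Forb_c D, embedding i, embedding j, i \o f =1 j \o h &
          range i `|` range j = setT /\
          is_amalgam (range i) (range (i \o f)) (range j)].

Definition indep (M : structure L) (A B C : set M) :=
  is_amalgam (A `|` B) B (B `|` C).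

Definition prioritised_edge (M : structure L) (a b : M) :=
  exists i, edge (R i) a b.

(* [R i] with [i = 0] is the first relation, with [i = 1] the second one (if
   [1 < m]). In the second clause [c] differs from [b]: every [a] is trivially
   independent from [b] over any set containing [b], so that allowing [c = b]
   would force each prioritised edge to have the colour of the first relation. *)
Definition condition_star (M : structure L) :=
  (forall (i j : 'I_m) T, i = 0 :> nat -> (j <= 1)%N ->
     ~ S [mset R i; R j; T]%mset) /\
  (forall (a b c : M) (B : set M), finite_set B -> c <> b ->
     indep [set a] (b |` B) [set c] -> prioritised_edge a b ->
     indep [set a] B [set c]).

Definition moves_almost_maximally (M : structure L) (f : aut M) :=
  forall X p : set M, finite_set X -> one_type X p ->
  exists2 a, p a & indep [set a] X [set f a].

End Prioritised.

(* Main.v *)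
Require Import Defs.
From mathcomp Require Import all_boot finmap multiset.
From mathcomp Require Import boolp classical_sets functions cardinality.

Set Implicit Arguments.
Unset Strict Implicit.
Unset Printing Implicit Defensive.

Local Open Scope classical_set_scope.

(** Write [B = h(A)] for a finite restriction of an automorphism [h], with
    [X] and [h^-1 g h (X)] contained in [A]. Realise the given type over [X] by
    some [a] independent from [A] over [X] with [r(a, g a)] prioritised, choose
    the image [b] of [a] independent from [g^-1 B] over [B] with [g b <> b], and
    choose the image [c] of [g a] independent from [g b] over [b B]. As
    [r(c, b) = r(g a, a)] is prioritised, Condition ( * ) removes [b] from the
    base, so [c] is independent from [g b] over [B], and by transitivity over
    [g h (X)]. Applying [g^-1] and then [k^-1] makes [[k,g] a] independent from
    [a] over [X], whatever the extension [k] of the restriction built so far.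
    A back-and-forth over all types then produces [k]. *)

Lemma aut_inj (L : Type) (X : structure L) (h : aut X) : injective h.
Proof. exact: can_inj (aut_funK h). Qed.

(** * Generic automorphisms by back-and-forth *)

Section Generic.
Variables (L : Type) (M : structure L).
Hypothesis M_countable : countable [set: M].

Definition agree (A : set M) (h k : aut M) := forall x, A x -> k x = h x.

Lemma finite_preimage_inj (f : M -> nat) (B : set nat) :
  injective f -> finite_set B -> finite_set (f @^-1` B).
Proof. by move=> finj; apply: finite_preimage => x y _ _; apply: finj. Qed.

(* The Baire category theorem for the topology of pointwise convergence, where
   each [D i] contains a dense open set. *)
Lemma aut_generic (I : countType) (D : I -> aut M -> Prop) :
  (forall i h A, finite_set A -> exists h' A',
     [/\ finite_set A', agree A h h' & forall k, agree A' h' k -> D i k]) ->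
  exists k, forall i, D i k.
Proof.
move=> dense.
have /countable_injP[f finj0] := M_countable.
have finj : injective f by move=> x y; apply: finj0; rewrite in_setT.
(* A state is an automorphism whose values are frozen on a finite set. Step [n] meets the condition
   coded by [n], then freezes the point coded by [n] and its preimage. Finiteness is a premise
   inside the statement so that [choice] gives a total step function. *)
have stepP (q : nat * (aut M * set M)) : exists q' : aut M * set M,
    finite_set q.2.2 ->
    [/\ finite_set q'.2, q.2.2 `<=` q'.2 /\ agree q.2.2 q.2.1 q'.1,
        forall k, agree q'.2 q'.1 k ->
          forall i : I, choice.unpickle q.1 = Some i -> D i k
      & forall x, f x = q.1 -> q'.2 x /\ q'.2 (aut_invfun q'.1 x)].
  case: q => n [h A] /=.
  have [finA|] := pselect (finite_set A); last by exists (h, A).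
  have [h' [A' [finA' hh' DA']]] : exists h' A', [/\ finite_set A',
      agree A h h' & forall k, agree A' h' k ->
        forall i : I, choice.unpickle n = Some i -> D i k].
    case: (choice.unpickle n : option I) => [i|]; last by exists h, A.
    have [h' [A' [finA' hh' DA']]] := dense i h A finA.
    by exists h', A'; split => // k hk j [<-]; apply: DA'.
  have finn : finite_set (f @^-1` [set n]).
    exact: finite_preimage_inj finj (finite_set1 n).
  exists (h', A `|` A' `|` f @^-1` [set n]
      `|` (aut_invfun h' @` (f @^-1` [set n]))) => _ /=; split.
  - by rewrite !finite_setU; do !split => //; exact: finite_image.
  - by split=> // x Ax; do 3!left.
  - by move=> k hk; apply: DA' => x A'x; apply: hk; left; left; right.
  - by move=> x fx; split; [left; right|right; exists x].
have [F FP] := choice stepP.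
pose id_aut :=
  @Aut _ M id id (fun=> erefl) (fun=> erefl) (fun _ _ _ => conj id id).
pose st := fix st n : aut M * set M :=
  if n is n'.+1 then F (n', st n') else (id_aut, set0).
have finst n : finite_set (st n).2.
  by elim: n => [|n IHn] //=; have [] := FP (n, st n) IHn.
have stS n := FP (n, st n) (finst n).
have st_le m n : (m <= n)%N ->
    (st m).2 `<=` (st n).2 /\ agree (st m).2 (st m).1 (st n).1.
  elim: n => [|n IHn]; first by rewrite leqn0 => /eqP->; split.
  rewrite leq_eqVlt ltnS => /orP[/eqP->|/IHn[sub agr]]; first by split.
  have [_ [/= sub' agr'] _ _] := stS n.
  split=> [x /sub /sub' //|x mx]; rewrite agr' ?agr //; exact: sub.
(* Stage [(f x).+1] is where [x] is sure to be frozen, both as an argument and as a value. *)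
pose kf x := (st (f x).+1).1 x.
pose kg y := aut_invfun (st (f y).+1).1 y.
have st_own x : (st (f x).+1).2 x by have [_ _ _ /(_ x erefl)[]] := stS (f x).
have kE n : forall x, (st n).2 x -> kf x = (st n).1 x.
  move=> x nx; have [_ h1] := st_le _ _ (leq_maxl n (f x).+1).
  have [_ h2] := st_le _ _ (leq_maxr n (f x).+1).
  by rewrite -(h1 _ nx) (h2 _ (st_own x)).
have kgK : cancel kg kf.
  move=> y; have [_ _ _ /(_ y erefl)[_ hy]] := stS (f y).
  by rewrite (kE (f y).+1) //; exact: aut_invfunK.
(* Two points are frozen at a common stage, so injectivity and edges are inherited from a single
   automorphism. *)
have k_loc x y : exists h : aut M, kf x = h x /\ kf y = h y.
  exists (st (maxn (f x).+1 (f y).+1)).1; split; apply: kE.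
    by have [sub _] := st_le _ _ (leq_maxl (f x).+1 (f y).+1); exact: sub.
  by have [sub _] := st_le _ _ (leq_maxr (f x).+1 (f y).+1); exact: sub.
have kinj : injective kf.
  by move=> x y; have [h [-> ->]] := k_loc x y; exact: aut_inj.
have kfK : cancel kf kg by move=> x; apply: kinj; rewrite kgK.
have kedge P x y : edge P (kf x) (kf y) <-> edge P x y.
  by have [h [-> ->]] := k_loc x y; exact: aut_edge.
exists (Aut kfK kgK kedge) => i.
have [_ _ Di _] := stS (choice.pickle i).
by apply: Di (choice.pickleK i) => x hx; exact: (kE (choice.pickle i).+1).
Qed.

End Generic.

(** * Independence of single points *)

Section Independence.
Variables (L : choiceType) (S : set {mset L}%mset) (m : nat) (R : 'I_m -> L).

(* [indep] for single points: as [blocked] only refers to [B], points of [B]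
   are independent from everything. *)
Definition free (D : structure L) (B : set D) (a c : D) :=
  ~ B a -> ~ B c -> exists i, [/\ edge (R i) a c, ~ blocked S R B a c i &
    forall j : 'I_m, (j < i)%N -> blocked S R B a c j].

Lemma indepP (D : structure L) (a : D) (B C : set D) :
  indep S R [set a] B C <-> forall c, C c -> free B a c.
Proof.
split=> [[_ H] c Cc Ba Bc|H]; first by apply: H; split => //; [left|right].
split=> [b Bb|x c [[->|//] Ba] [[//|Cc] Bc]]; last exact: H.
by split; [right|left].
Qed.

Lemma indep1P (D : structure L) (a c : D) (B : set D) :
  indep S R [set a] B [set c] <-> free B a c.
Proof. by rewrite indepP; split=> [H|H _ -> //]; exact: H. Qed.

(** Outside the base, independence would give an edge from [a] to itself. This keeps a point
    independent from all elements of a set out of that set, unless it lies in the base. *)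
Lemma free_diag (D : structure L) (B : set D) (a : D) : free B a a -> B a.
Proof.
move=> H; apply: contrapT => Ba; have [i [e _ _]] := H Ba Ba.
exact: edge_irr e.
Qed.

Lemma blocked_sym (D : structure L) (B : set D) (a c : D) i :
  blocked S R B a c i -> blocked S R B c a i.
Proof.
move=> [b [P [Q [Bb ab bc SPQ]]]]; exists b, Q, P.
split=> //; [exact: edge_sym|exact: edge_sym|].
by rewrite (msetDC [mset Q]%mset).
Qed.

Lemma free_sym (D : structure L) (B : set D) (a c : D) :
  free B a c -> free B c a.
Proof.
move=> H Bc Ba; have [i [e nb b]] := H Ba Bc.
exists i; split=> [|/blocked_sym //|j /b /blocked_sym //]; exact: edge_sym.
Qed.

Lemma blocked_embedding (D E : structure L) (f : D -> E) (T : Type)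
    (s : T -> D) (a c : D) i :
  embedding f ->
  blocked S R (range (f \o s)) (f a) (f c) i <-> blocked S R (range s) a c i.
Proof.
move=> [_ fe]; split=> [[_ [P [Q [[t _ <-] /fe ab /fe bc SPQ]]]]|].
  by exists (s t), P, Q; split=> //; exists t.
move=> [_ [P [Q [[t _ <-] /fe ab /fe bc SPQ]]]].
by exists (f (s t)), P, Q; split=> //; exists t.
Qed.

Variable M : structure L.

Lemma blocked_aut (h : aut M) (B : set M) a c i :
  blocked S R (h @` B) (h a) (h c) i <-> blocked S R B a c i.
Proof.
split=> [[_ [P [Q [[b Bb <-] ab bc SPQ]]]]|].
  by exists b, P, Q; split=> //; apply: (aut_edge h _ _ _).1.
move=> [b [P [Q [Bb ab bc SPQ]]]].
by exists (h b), P, Q; split=> //; exact: (aut_edge h _ _ _).2.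
Qed.

Lemma free_aut (h : aut M) (B : set M) a c :
  free B a c -> free (h @` B) (h a) (h c).
Proof.
move=> H Ba Bc.
have nBa : ~ B a by move=> Ba'; apply: Ba; exists a.
have nBc : ~ B c by move=> Bc'; apply: Bc; exists c.
have [i [e nb b]] := H nBa nBc; exists i.
by split=> [||j /b jb];
  [exact: (aut_edge h _ _ _).2|move/blocked_aut|apply/blocked_aut].
Qed.

Lemma free_aut_fix (h : aut M) (B : set M) a c :
  (forall x, B x -> h x = x) -> free B a c -> free B (h a) (h c).
Proof.
move=> fixB /(free_aut (h := h)); suff -> : h @` B = B by [].
apply/seteqP; split=> [_ [x Bx <-]|x Bx]; first by rewrite fixB.
by exists x => //; exact: fixB.
Qed.

(** * Monotonicity, stationarity and transitivity *)

Hypothesis edge_uniq : forall P Q (a b : M), edge P a b -> edge Q a b -> P = Q.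
Hypothesis no_triangle : forall (a b c : M) P Q T,
  edge P a b -> edge Q b c -> edge T a c -> ~ S [mset P; Q; T]%mset.

(** A larger base blocks at least as many colours, but never the colour of the actual edge from [a]
    to [c], since [M] contains no triangle of [S]. *)
Lemma free_widen (B B' : set M) a c : B `<=` B' -> free B a c -> free B' a c.
Proof.
move=> sub H Ba Bc.
have nBa : ~ B a by move/sub.
have nBc : ~ B c by move/sub.
have [i [e _ b]] := H nBa nBc.
exists i; split=> // [[y [P [Q [_ ab bc]]]]|j /b[y [P [Q [By ab bc SPQ]]]]].
  exact: no_triangle ab bc e.
by exists y, P, Q; split=> //; exact: sub.
Qed.

Definition same_edges (B : set M) (a a' : M) :=
  forall x P, B x -> edge P a x <-> edge P a' x.

Lemma same_edges_blocked (B : set M) a a' c i :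
  same_edges B a a' -> blocked S R B a c i -> blocked S R B a' c i.
Proof.
move=> eqB [b [P [Q [Bb /eqB ab bc SPQ]]]].
by exists b, P, Q; split=> //; exact: ab.
Qed.

Lemma same_edges_sym (B : set M) a a' : same_edges B a a' -> same_edges B a' a.
Proof. by move=> H x P Bx; split=> /H; apply. Qed.

(** For fixed [c], the blocked colours depend only on the edges to [B], so the least unblocked index
    is the same for [a] and [a']. *)
Lemma free_color (B : set M) a a' c :
  same_edges B a a' -> ~ B a -> ~ B a' -> ~ B c -> free B a c -> free B a' c ->
  exists i, edge (R i) a c /\ edge (R i) a' c.
Proof.
move=> eqB Ba Ba' Bc /(_ Ba Bc)[i [e nb b]] /(_ Ba' Bc)[i' [e' nb' b']].
exists i; split=> //; suff -> : i = i' by [].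
have eqB' := same_edges_sym eqB.
have [lt|lt|/ord_inj //] := ltngtP i i'; exfalso.
  by apply: nb; apply: same_edges_blocked eqB' _; exact: b'.
by apply: nb'; apply: same_edges_blocked eqB _; exact: b.
Qed.

Lemma stationarity (B : set M) a a' c :
  same_edges B a a' -> ~ B a -> ~ B a' -> free B a c -> free B a' c ->
  forall P, edge P a c <-> edge P a' c.
Proof.
move=> eqB Ba Ba' fa fa' P.
have [/eqB //|Bc] := pselect (B c).
have [i [e e']] := free_color eqB Ba Ba' Bc fa fa'.
by split=> [/(edge_uniq e)|/(edge_uniq e')] <-.
Qed.

Hypothesis extension : forall (a : M) (X C : set M),
  finite_set X -> finite_set C ->
  exists w : aut M, (forall x, X x -> w x = x) /\
                    forall c, C c -> free X (w a) c.

(* A conjugate [w u] of [u] over [Z] that is independent from [v W] over [Z]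
   has the same type as [u] over [v W], by stationarity applied twice. *)
Lemma free_trans (Z W : set M) u v : finite_set W -> Z `<=` W ->
  (forall x, W x -> free Z u x) -> free W u v -> free Z u v.
Proof.
move=> finW ZW uW uv Zu Zv.
have nW x : ~ Z x -> (forall y, W y -> free Z x y) -> ~ W x.
  by move=> Zx H Wx; apply: Zx; exact: free_diag (H x Wx).
have [w [wZ wW]] : exists w : aut M, (forall x, Z x -> w x = x) /\
    forall c, (W `|` [set v]) c -> free Z (w u) c.
  by apply: extension; rewrite ?finite_setU //; exact: sub_finite_set ZW _.
have Zu' : ~ Z (w u).
  move=> Zwu; apply: Zu; suff <- : w u = u by [].
  by apply: (aut_inj (h := w)); rewrite wZ.
have eqZ : same_edges Z u (w u).
  by move=> x P Zx; rewrite -{2}(wZ _ Zx); apply: iff_sym; exact: aut_edge.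
have eqW : same_edges W u (w u).
  move=> x P Wx; apply: stationarity eqZ Zu Zu' _ _ P; first exact: uW.
  by apply: wW; left.
have fv : free Z (w u) v by apply: wW; right.
have Wu : ~ W u by exact: nW.
have Wu' : ~ W (w u) by apply: nW => // y Wy; apply: wW; left.
have eqv := stationarity eqW Wu Wu' uv (free_widen ZW fv).
have [i [e nb b]] := fv Zu' Zv.
have eqZ' := same_edges_sym eqZ.
exists i; split=> [|/(same_edges_blocked eqZ) //|j /b]; first exact/eqv.
exact: same_edges_blocked eqZ'.
Qed.

Definition type_over (X : set M) (a : M) : set M :=
  [set b | exists h : aut M, (forall x, X x -> h x = x) /\ h a = b].

(** A finite orbit could serve as [C] in [extension]; some conjugate of [a] would then be
    independent from itself, hence lie in [X]. *)
Lemma type_over_infinite (X : set M) a :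
  finite_set X -> ~ X a -> infinite_set (type_over X a).
Proof.
move=> finX Xa finp; have [w [wX wp]] := extension a finX finp.
have Xwa : X (w a) by apply: free_diag; apply: wp; exists w.
by apply: Xa; suff <- : w a = a by []; apply: (aut_inj (h := w)); rewrite wX.
Qed.

Hypothesis star : forall (a b c : M) (B : set M), finite_set B -> c <> b ->
  free (b |` B) a c -> prioritised_edge R a b -> free B a c.

(** * Prioritised realisations and the commutator step *)

Variable g : aut M.
Hypothesis g_prioritised : forall (X p : set M), finite_set X ->
  one_type X p -> infinite_set p ->
  infinite_set (p `&` [set a | prioritised_edge R a (g a)]).

Lemma prioritised_realisation (X : set M) a : finite_set X -> ~ X a ->
  exists w : aut M, (forall x, X x -> w x = x) /\
                    prioritised_edge R (w a) (g (w a)).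
Proof.
move=> finX Xa; have inf := type_over_infinite finX Xa.
have tp : one_type X (type_over X a) by exists a.
have [b [[w [wX <-]] pb]] := infinite_setN0 (g_prioritised finX tp inf).
by exists w.
Qed.

(** First [w] makes the point independent from [C]. A prioritised realisation of its type over [X]
    and [C] together is then reached by an automorphism fixing both, which preserves the
    independence. *)
Lemma free_prioritised_realisation (X C : set M) a :
  finite_set X -> finite_set C -> ~ X a ->
  exists w : aut M, [/\ forall x, X x -> w x = x,
    forall c, C c -> free X (w a) c & prioritised_edge R (w a) (g (w a))].
Proof.
move=> finX finC Xa; have [w [wX wC]] := extension a finX finC.
have wXa : ~ X (w a).
  move=> Xwa; apply: Xa; suff <- : w a = a by [].
  by apply: (aut_inj (h := w)); rewrite wX.
have XCwa : ~ (X `|` C) (w a).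
  by case=> // Cwa; apply: wXa; exact: free_diag (wC _ Cwa).
have finXC : finite_set (X `|` C) by rewrite finite_setU.
have [v [vXC pv]] := prioritised_realisation finXC XCwa.
exists (aut_mul v w); split=> //= [x Xx|c Cc].
  by rewrite wX // vXC //; left.
have vX x : X x -> v x = x by move=> Xx; apply: vXC; left.
by have := free_aut_fix vX (wC c Cc); rewrite (vXC c) //; right.
Qed.

Lemma commutator_dense (X : set M) (a0 : M) (h : aut M) (A : set M) :
  finite_set X -> finite_set A -> exists h' A',
  [/\ finite_set A', agree A h h' & forall k, agree A' h' k ->
     exists2 a, type_over X a0 a & free X a (aut_comm k g a)].
Proof.
move=> finX finA0; have [Xa0|Xa0] := pselect (X a0).
  exists h, A; split=> // k _; exists a0 => //.
  by exists (aut_mul (aut_inv h) h); split=> [x _|] /=; exact: aut_funK.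
(* The last set ensures that [B], the image of [A1] under [h], contains [g h(X)]. *)
pose A1 := A `|` X `|` ((aut_mul (aut_inv h) (aut_mul g h)) @` X).
have finA1 : finite_set A1.
  by rewrite !finite_setU; do !split => //; exact: finite_image.
have XA1 : X `<=` A1 by move=> x Xx; left; right.
have [u [uX uA pu]] := free_prioritised_realisation finX finA1 Xa0.
set a := u a0 in uA pu.
have A1a : ~ A1 a.
  move=> /uA/free_diag Xa; apply: Xa0; suff <- : u a0 = a0 by [].
  by apply: (aut_inj (h := u)); rewrite uX.
pose B := h @` A1.
have finB : finite_set B by exact: finite_image.
have Bha : ~ B (h a) by move=> [x A1x /aut_inj xa]; rewrite -xa in A1a.
(* The prioritised edge from [b] to [g b] serves to give [g b <> b], which [star] requires. *)
have [w [wB wC pw]] := free_prioritised_realisation finB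
  (finite_image (aut_inv g) finB) Bha.
pose h1 := aut_mul w h; pose b := h1 a.
have h1E x : A1 x -> h1 x = h x by move=> A1x; rewrite /= wB //; exists x.
have gb : g b <> b.
  by move=> gbb; case: pw => i; rewrite -/b gbb; exact: edge_irr.
have finbB : finite_set (b |` B) by rewrite finite_setU.
have [v [vB vC]] := extension (h1 (g a)) finbB (finite_set1 (g b)).
pose h2 := aut_mul v h1; pose c := h2 (g a).
have h2a : h2 a = b by rewrite /= vB //; left.
have h2E x : A1 x -> h2 x = h x.
  by move=> A1x; rewrite -[h2 x]/(v (h1 x)) h1E // vB //; right; exists x.
have cb : prioritised_edge R c b.
  have [i e] := pu; exists i; rewrite -h2a; apply/aut_edge; exact: edge_sym.
have cgb : free B c (g b) by exact: star finB gb (vC _ erefl) cb.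
(* [d] is the value at [a] of the commutator of [h2] and [g]. Freezing [h2] at [g a] and at [d]
   forces this value for every extension [k]. *)
pose d := aut_inv h2 (aut_inv g c).
exists h2, (A1 `|` [set a] `|` [set g a] `|` [set d]); split.
- by do 3![rewrite finite_setU; split=> //].
- by move=> x Ax; apply: h2E; rewrite /A1; left; left.
move=> k hk; exists a; first by exists u.
have kd : aut_comm k g a = d.
  rewrite /aut_comm /= hk; last by left; right.
  apply: (aut_inj (h := k)); rewrite aut_invfunK hk; last by right.
  by rewrite /d [RHS]aut_invfunK.
rewrite kd.
(* The independence of [a] from [A1] over [X], carried over by [h1]. *)
have bB x : B x -> free (h @` X) b x.
  move=> [y A1y <-]; rewrite -h1E //.
  suff -> : h @` X = h1 @` X by apply: free_aut; exact: uA.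
  by apply: eq_imagel => z Xz; rewrite h1E //; exact: XA1.
have hXB : h @` X `<=` B by exact: image_subset.
have bgB x : B x -> free (h @` X) b (aut_inv g x).
  by move=> Bx; apply: free_trans bB _ => //; apply: wC; exists x.
have gbB x : B x -> free (g @` (h @` X)) (g b) x.
  by move=> /bgB/(free_aut (h := g)); rewrite /= aut_invfunK.
have ghXB : g @` (h @` X) `<=` B.
  move=> _ [_ [x Xx <-] <-]; exists (aut_inv h (g (h x))).
    by right; exists x.
  by rewrite /= aut_invfunK.
(* Second transitivity through [B]: [g b] is independent from [B] over [g h(X)], and from [c] over
   [B] by the symmetric form of [cgb]. *)
have gbc : free (g @` (h @` X)) (g b) c.
  by apply: free_trans gbB _ => //; exact: free_sym.
have image_inv (e : aut M) (Y : set M) : aut_inv e @` (e @` Y) = Y.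
  apply/seteqP; split=> [_ [_ [x Yx <-] <-]|x Yx]; first by rewrite /= aut_funK.
  by exists (e x); [exists x|exact: aut_funK].
have : free (h @` X) b (aut_inv g c).
  by have := free_aut (h := aut_inv g) gbc; rewrite image_inv /= aut_funK.
have -> : h @` X = h2 @` X.
  by apply: eq_imagel => x Xx; rewrite h2E //; exact: XA1.
move/(free_aut (h := aut_inv h2)).
by rewrite image_inv -h2a [aut_inv h2 (h2 a)]aut_funK.
Qed.

End Independence.

(** * The independence axioms in the Fraisse limit *)

Section FraisseLimit.
Variables (L : choiceType) (S : set {mset L}%mset) (m : nat) (R : 'I_m -> L).
Variable M : structure L.
Hypothesis limM : fraisse_limit (Forb_c S) M.

Lemma induced_embedding (A : set M) :
  embedding (val : induced A -> M).
Proof. by split=> //; exact: val_inj. Qed.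

Lemma induced_Forb (A : set M) : finite_set A -> Forb_c S (induced A).
Proof.
move=> finA; have [_ _ /(_ (induced A))[_]] := limM; apply.
split; last by exists val; exact: induced_embedding.
suff -> : [set: induced A] = val @^-1` A.
  by apply: finite_preimage => // x y _ _; exact: val_inj.
by apply/seteqP; split=> // x _; exact: set_mem (valP x).
Qed.

Lemma limit_edge_uniq P Q (a b : M) : edge P a b -> edge Q a b -> P = Q.
Proof.
move=> eP eQ.
have [_ cplt _] : Forb_c S (induced [set a; b]).
  by apply: induced_Forb; rewrite finite_setU.
have aA : a \in [set a; b] by rewrite inE; left.
have bA : b \in [set a; b] by rewrite inE; right.
have ab : (exist _ a aA : induced [set a; b]) <> exist _ b bA.
  by move=> [ab]; rewrite ab in eP; exact: edge_irr eP.
by have [T [_ uT]] := cplt _ _ ab; rewrite -(uT P) // -(uT Q).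
Qed.

Lemma limit_no_triangle (a b c : M) P Q T :
  edge P a b -> edge Q b c -> edge T a c -> ~ S [mset P; Q; T]%mset.
Proof.
move=> eP eQ eT.
pose A := [set a; b] `|` [set c].
have [_ _ notri] : Forb_c S (induced A).
  by apply: induced_Forb; rewrite !finite_setU.
have aA : a \in A by rewrite inE; left; left.
have bA : b \in A by rewrite inE; left; right.
have cA : c \in A by rewrite inE; right.
exact: (notri (exist _ a aA) (exist _ b bA) (exist _ c cA)).
Qed.

Hypothesis semifree : prioritised_semifree S R.

(** The semi-free amalgam of [aX] and [XC] over [X] embeds in [M]. Homogeneity first makes this
    embedding the inclusion on [XC], then extends its restriction to [aX] to an automorphism [w]. *)
Lemma limit_extension (a : M) (X C : set M) :
  finite_set X -> finite_set C ->
  exists w : aut M, (forall x, X x -> w x = x) /\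
                    forall c, C c -> free S R X (w a) c.
Proof.
move=> finX finC.
pose inc (Y Z : set M) (YZ : Y `<=` Z) (x : induced Y) : induced Z :=
  exist _ (val x) (mem_set (YZ _ (set_mem (valP x)))).
have inc_emb Y Z (YZ : Y `<=` Z) : embedding (inc Y Z YZ).
  by split=> // x y /(congr1 val) xy; exact: val_inj.
have sA : X `<=` a |` X by move=> x; right.
have sC : X `<=` X `|` C by move=> x; left.
have finA : finite_set (a |` X) by rewrite finite_setU.
have finXC : finite_set (X `|` C) by rewrite finite_setU.
have [D [i [j [FD iemb jemb ij [_ [_ am]]]]]] := semifree.2 _ _ _ _ _
  (induced_Forb finA) (induced_Forb finX) (induced_Forb finXC)
  (inc_emb _ _ sA) (inc_emb _ _ sC).
have [_ homog /(_ D)[/(_ FD)[_ [f0 f0emb]] _]] := limM.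
have emb_comp (E F G : structure L) (p : E -> F) (q : F -> G) :
    embedding p -> embedding q -> embedding (q \o p).
  move=> [pi pe] [qi qe]; split; first exact: inj_comp.
  by move=> P x y; rewrite /= qe.
have [h hE] := homog _ _ finXC (emb_comp _ _ _ _ _ jemb f0emb).
have hemb : embedding (aut_inv h : M -> M).
  by split; [exact: aut_inj|exact: aut_edge].
pose f := aut_inv h \o f0.
have femb : embedding f by exact: emb_comp.
have fj (x : induced (X `|` C)) : f (j x) = val x.
  by apply: (aut_inj (h := h)); rewrite [LHS]aut_invfunK hE.
have [w wE] := homog _ _ finA (emb_comp _ _ _ _ _ iemb femb).
have fX (x : induced X) : f (i (inc _ _ sA x)) = val x.
  by have /= -> := ij x; rewrite fj.
have wX x : X x -> w x = x.
  move=> Xx; pose x' : induced X := exist _ x (mem_set Xx).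
  exact: etrans (wE (inc _ _ sA x')) (fX x').
exists w; split=> // c Cc Xwa Xc.
have aA : a \in a |` X by rewrite inE; left.
have cC : c \in X `|` C by rewrite inE; right.
pose a' : induced (a |` X) := exist _ a aA.
pose c' : induced (X `|` C) := exist _ c cC.
have wa : w a = f (i a') by rewrite -[a]/(val a') wE.
have fc : c = f (j c') by rewrite fj.
(* The base of the amalgam is mapped onto [X], so the colours blocked in [D] and in [M]
   correspond. *)
have rX : range (f \o (i \o inc _ _ sA)) = X.
  apply/seteqP; split=> [_ [x _ <-]|x Xx].
    by rewrite /= fX; exact: set_mem (valP x).
  by exists (exist _ x (mem_set Xx)) => //=; exact: fX.
have [||k [e nb b]] := am (i a') (j c').
- split; first by exists a'.
  by move=> [x _ xa]; apply: Xwa; rewrite wa -rX; exists x; rewrite //= -xa.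
- split; first by exists c'.
  by move=> [x _ xc]; apply: Xc; rewrite fc -rX; exists x; rewrite //= -xc.
exists k; rewrite wa fc -rX; split=> [||l /b].
- by apply/femb.2.
- by move/(blocked_embedding S R _ _ _ _ femb).
- by move/(blocked_embedding S R _ _ _ _ femb).
Qed.

End FraisseLimit.

(** * Back-and-forth over all types *)

Theorem theorem5p6 (L : choiceType) (S : set {mset L}%mset) (m : nat)
    (R : 'I_m -> L) (M : structure L) (g : aut M) :
  triangles S ->
  injective R -> range R `<` [set: L] ->
  prioritised_semifree S R ->
  fraisse_limit (Forb_c S) M ->
  condition_star S R M ->
  (forall X p : set M, finite_set X -> one_type X p -> infinite_set p ->
     infinite_set (p `&` [set a | prioritised_edge R a (g a)])) ->
  exists k : aut M, moves_almost_maximally S R (aut_comm k g).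
Proof.
move=> _ _ _ semifree limM [_ star] g_prio.
have M_countable : countable [set: M] by case: limM.
have /countable_injP[f finj0] := M_countable.
have finj : injective f by move=> x y; apply: finj0; rewrite in_setT.
(* Finite sets and points are coded through [f], which makes the conditions countable. A number
   coding no point imposes nothing. *)
pose D (q : seq nat * nat) (k : aut M) := forall a, f a = q.2 ->
  exists2 b, type_over (f @^-1` [set` q.1]) a b &
             free S R (f @^-1` [set` q.1]) b (aut_comm k g b).
have [k kD] : exists k, forall q, D q k.
  apply: aut_generic => // -[s n] h A finA.
  have [[a fa]|na] := pselect (exists a, f a = n); last first.
    by exists h, A; split=> // k _ a fa; case: na; exists a.
  have finX : finite_set (f @^-1` [set` s]).
    exact: finite_preimage_inj (finite_seq s).
  have star' (a1 b1 c1 : M) (B : set M) : finite_set B -> c1 <> b1 ->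
      free S R (b1 |` B) a1 c1 -> prioritised_edge R a1 b1 -> free S R B a1 c1.
    by move=> finB cb /indep1P H p; apply/indep1P; exact: star H p.
  have [h' [A' [finA' hh' H]]] := commutator_dense (limit_edge_uniq limM)
    (limit_no_triangle limM) (limit_extension limM semifree) star' g_prio a h
    finX finA.
  exists h', A'; split=> // k hk a'; rewrite /= -fa => /finj ->; exact: H.
exists k => X p finX [a ->].
(* The list [s] of codes determines [X], as [f] is injective. *)
have /finite_seqP[s sE] := finite_image f finX.
have XE : f @^-1` [set` s] = X.
  rewrite -sE; apply/seteqP; split=> [x [y Xy /finj <- //]|x Xx]; by exists x.
have [b pb fb] := kD (s, f a) a erefl.
by rewrite /= XE in pb fb; exists b => //; apply/indep1P.
Qed.
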